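(* Let $\mu>0$, let $\hat r:[0,\infty)\to\mathbb{R}$ be concave and non-decreasing with $\hat r(0)=0$, and for any real matrix $\mathbf{X}$ put $r(\mathbf{X})=\sum_i\hat r(\sigma_i(\mathbf{X}))$. Let $\gamma>0$ be a threshold for $(\mu,\hat r)$ (see context). Let $\mathbf{Z}\in\mathbb{R}^{m\times n}$ have exactly $\hat k$ singular values larger than $\gamma$, and let $\mathbf{U}_{\hat k}\mathbf{\Sigma}_{\hat k}\mathbf{V}_{\hat k}^\top$ be the rank-$\hat k$ (truncated) SVD of $\mathbf{Z}$. Assume that $\mathbf{Q}\in\mathbb{R}^{m\times k}$, where $k\ge\hat k$, is orthogonal (i.e. $\mathbf{Q}^\top\mathbf{Q}=\mathbf{I}$) and $\operatorname{span}(\mathbf{U}_{\hat k})\subseteq\operatorname{span}(\mathbf{Q})$. Then $$\operatorname{prox}_{\mu r}(\mathbf{Z})=\mathbf{Q}\,\operatorname{prox}_{\mu r}(\mathbf{Q}^\top\mathbf{Z}).$$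
   Context: $\sigma_i(\mathbf{X})$ is the $i$-th largest singular value of $\mathbf{X}$ and $\operatorname{span}(\cdot)$ is the column space. For a matrix $\mathbf{A}$ of any size, $\operatorname{prox}_{\mu r}(\mathbf{A})=\operatorname{Arg\,min}_{\mathbf{X}}\frac12\|\mathbf{X}-\mathbf{A}\|_F^2+\mu r(\mathbf{X})$, the minimization being over matrices $\mathbf{X}$ of the same size as $\mathbf{A}$; it is in general a set of minimizers, and $\mathbf{Q}\operatorname{prox}_{\mu r}(\mathbf{Q}^\top\mathbf{Z})$ denotes $\{\mathbf{Q}\mathbf{X}:\mathbf{X}\in\operatorname{prox}_{\mu r}(\mathbf{Q}^\top\mathbf{Z})\}$. A threshold for $(\mu,\hat r)$ is a number $\gamma>0$ such that for every $\sigma\in[0,\gamma]$ the only minimizer of $\frac12(y-\sigma)^2+\mu\hat r(y)$ over $y\ge0$ is $y=0$. *)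

(* Defs.v *)
From mathcomp Require Import all_boot all_order all_algebra.
From mathcomp Require Import polyrcf.
From mathcomp Require Import boolp classical_sets set_interval reals convex.

Set Implicit Arguments.
Unset Strict Implicit.
Unset Printing Implicit Defensive.

Import Order.TTheory GRing.Theory Num.Theory.

Local Open Scope classical_set_scope.
Local Open Scope ring_scope.

Section SingularValues.
Variable R : realType.

(* The real eigenvalues of A repeated according to their algebraic
   multiplicity, in decreasing order ([rootsR] lists the distinct real roots of
   a polynomial in increasing order). *)
Definition eigenvalues n (A : 'M[R]_n) : seq R :=
  flatten [seq nseq (mup x (char_poly A)) x | x <- rev (rootsR (char_poly A))].

(* Square root of the eigenvalue of X^T X of rank i.  Indices start at 0, and
   only the indices i < minn m n are meaningful. *)
Definition singular_value m n (X : 'M[R]_(m, n)) (i : nat) : R :=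
  Num.sqrt (nth 0 (eigenvalues (X^T *m X)) i).

Definition singular_mx m n (X : 'M[R]_(m, n)) : 'M[R]_(m, n) :=
  \matrix_(i < m, j < n) (singular_value X i *+ (i == j :> nat)).

Definition is_svd m n (Z : 'M[R]_(m, n)) (U : 'M[R]_m) (V : 'M[R]_n) : Prop :=
  [/\ U^T *m U = 1%:M, V^T *m V = 1%:M & Z = U *m singular_mx Z *m V^T].

(* Uk and Vk consist of the first k columns of the orthogonal factors of some
   singular value decomposition of Z, and Sk is the k x k diagonal matrix of the
   k largest singular values. *)
Definition is_truncated_svd m n k (Z : 'M[R]_(m, n))
    (Uk : 'M[R]_(m, k)) (Sk : 'M[R]_k) (Vk : 'M[R]_(n, k)) : Prop :=
  exists (U : 'M[R]_m) (V : 'M[R]_n) (km : (k <= m)%N) (kn : (k <= n)%N),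
    [/\ is_svd Z U V,
        Uk = colsub (widen_ord km) U,
        Sk = diag_mx (\row_(i < k) singular_value Z i) &
        Vk = colsub (widen_ord kn) V].

End SingularValues.

Section Prox.
Variable R : realType.

Definition argmin (T : Type) (D : set T) (f : T -> R) : set T :=
  [set x | D x /\ forall y, D y -> f x <= f y].

Definition frobenius_norm m n (A : 'M[R]_(m, n)) : R :=
  Num.sqrt (\sum_(i < m) \sum_(j < n) A i j ^+ 2).

(* Only the values of rhat on [0, +oo[ matter, here and in [is_threshold]. *)
Definition spectral_reg (rhat : R -> R) m n (X : 'M[R]_(m, n)) : R :=
  \sum_(i < minn m n) rhat (singular_value X i).

Definition prox (mu : R) (rhat : R -> R) m n (A : 'M[R]_(m, n)) :
    set 'M[R]_(m, n) :=
  argmin [set: 'M[R]_(m, n)] (fun X =>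
    2^-1 * frobenius_norm (X - A) ^+ 2 + mu * spectral_reg rhat X).

Definition is_threshold (mu : R) (rhat : R -> R) (gamma : R) : Prop :=
  0 < gamma /\
  forall sigma, 0 <= sigma <= gamma ->
    argmin [set y | 0 <= y]
      (fun y => 2^-1 * (y - sigma) ^+ 2 + mu * rhat y) = [set 0].

End Prox.

(* Main.v *)
(* Write X = A diag(s) B^T with s_i > 0 and set h(y) = y^2/2 + mu rhat(y), so that
   up to a constant the objective at X is
   sum_i (h(s_i) - s_i (A^T Z B)_ii); the threshold says h(y) > gamma y for y > 0.
   The numbers w_ji = ((Uk^T A)_ji^2 + (Vk^T B)_ji^2) / 2 are doubly
   substochastic and
   (A^T Z B)_ii <= sum_j sigma_j w_ji + gamma (1 - sum_j w_ji).
   Choosing, for each j, y_j in {0, s_1, ..., s_p} minimizing h(y) - sigma_j y, the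
   matrix X' = Uk diag(y) Vk^T lowers the objective by at least
   sum_i (1 - sum_j w_ji) (h(s_i) - gamma s_i) >= 0, and equality forces every
   column of A into span(Uk).  So the minimization can be restricted to
   matrices Q Y, where the objective is that of Q^T Z at Y plus a constant. *)
Require Import Defs.
From mathcomp Require Import all_boot all_order all_algebra.
From mathcomp Require Import complex polyrcf.
From mathcomp Require Import boolp classical_sets set_interval reals convex.
From mathcomp Require Import ring lra.

Set Implicit Arguments.
Unset Strict Implicit.
Unset Printing Implicit Defensive.

Import Order.TTheory GRing.Theory Num.Theory.

Local Open Scope classical_set_scope.
Local Open Scope ring_scope.

(** * Linear algebra: characteristic polynomials of products and thin singular value
    decompositions *)

(** The block matrix [M] is made block triangular in two ways: from the right by a factor of
    determinant 1, from the left by one of determinant [x ^+ p]. Nothing is divided by [x], so [x]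
    may be the indeterminate of a polynomial ring. *)
Lemma det_sylvester (K : comNzRingType) n p (x : K)
    (A : 'M[K]_(n, p)) (B : 'M[K]_(p, n)) :
  x ^+ p * \det (x%:M - A *m B) = x ^+ n * \det (x%:M - B *m A).
Proof.
pose M := block_mx x%:M A B 1%:M.
have detM : \det M = \det (x%:M - A *m B).
  have: M *m block_mx 1%:M 0 (- B) 1%:M = block_mx (x%:M - A *m B) A 0 1%:M.
    by rewrite mulmx_block !mulmx1 !mulmx0 !mul1mx !add0r mulmxN subrr.
  move/(congr1 determinant); rewrite det_mulmx det_lblock det_ublock !det1.
  by rewrite !mulr1.
have: block_mx 1%:M 0 (- B) x%:M *m M = block_mx x%:M A 0 (x%:M - B *m A).
  rewrite mulmx_block !mul1mx !mul0mx !mulNmx !addr0 mulmx1 addrC.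
  by rewrite [- (B *m A) + _]addrC scalar_mxC addrC addNr.
move/(congr1 determinant); rewrite det_mulmx det_lblock det_ublock det1 mul1r.
by rewrite !det_scalar detM.
Qed.

Lemma char_poly_sylvester (K : comNzRingType) n p
    (A : 'M[K]_(n, p)) (B : 'M[K]_(p, n)) :
  'X^p * char_poly (A *m B) = 'X^n * char_poly (B *m A).
Proof. by rewrite /char_poly /char_poly_mx !map_mxM det_sylvester. Qed.

(* The spectral theorem is available over R[i] only; a nonzero eigenvalue found
   there is real, hence an eigenvalue over R. *)
Lemma symmetric_nonzero_eigenvalue (R : rcfType) n (M : 'M[R]_n) :
  M^T = M -> M != 0 -> exists2 l : R, l != 0 & eigenvalue M l.
Proof.
move=> symM nzM; pose f := real_complex R; pose A := map_mx f M.
have hermA : A \is hermsymmx.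
  apply: realsym_hermsym.
    apply/is_hermitianmxP; rewrite expr0 scale1r map_mx_id //.
    by rewrite /A map_trmx symM.
  by apply/mxOverP => i j; rewrite mxE; apply/complex_realP; exists (M i j).
have := hermitian_spectral_diag_real hermA.
have /hermitian_normalmx/orthomx_spectralP := hermA.
set P := spectralmx A; set d := spectral_diag A => defA dreal.
have uP : P \in unitmx by exact: spectral_unit.
have [i nzi] : exists i, d 0 i != 0.
  apply/existsP; apply: contraNT nzM; rewrite negb_exists => /forallP d0.
  have dE : d = 0 by apply/rowP=> i; rewrite mxE; apply/eqP; rewrite -[_ == _]negbK.
  have : A = 0 by rewrite defA dE linear0 mulmx0 mul0mx.
  move=> /matrixP A0; apply/eqP/matrixP=> i j; have := A0 i j.
  by rewrite !mxE => /(fmorph_inj (real_complex R)) ->.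
have /complex_realP[l dl] : d 0 i \is Num.real by exact: (mxOverP dreal).
exists l; first by apply: contraNneq nzi => l0; rewrite dl l0.
rewrite eigenvalue_root_char -(fmorph_root (real_complex R)) map_char_poly.
rewrite -eigenvalue_root_char; apply/eigenvalueP; exists (row i P).
  have PA : P *m A = diag_mx d *m P by rewrite {1}defA -mulmxA mulKVmx.
  by rewrite -row_mul PA row_mul row_diag_mx -scalemxAl -rowE dl.
apply/negP => /eqP r0; have := mulmxV uP => /(congr1 (row i)).
rewrite row_mul r0 mul0mx => /rowP/(_ i); rewrite !mxE eqxx => /esym/eqP.
by rewrite oner_eq0.
Qed.

Lemma trmx_mul_self_eq0 (R : realDomainType) m n (A : 'M[R]_(m, n)) :
  A^T *m A = 0 -> A = 0.
Proof.
move=> A0; apply/matrixP=> i j; have := congr1 (fun M : 'M_n => M j j) A0.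
rewrite !mxE => /eqP; rewrite psumr_eq0; last first.
  by move=> k _; rewrite mxE -expr2 sqr_ge0.
by move=> /allP/(_ i); rewrite mem_index_enum mxE -expr2 sqrf_eq0 => /(_ isT)/eqP.
Qed.

(** Normalize an eigenvector of [X^T *m X] with nonzero eigenvalue l to get [b]. Then l is the
    squared norm of [X *m b], hence positive, and s is its square root and a = s^-1 X b. *)
Lemma singular_pair (R : rcfType) m n (X : 'M[R]_(m, n)) : X != 0 ->
  exists (s : R) (a : 'cV[R]_m) (b : 'cV[R]_n),
    [/\ 0 < s, a^T *m a = 1%:M, b^T *m b = 1%:M, X *m b = s *: a
      & a^T *m X = s *: b^T].
Proof.
move=> nzX; have symM : (X^T *m X)^T = X^T *m X by rewrite trmx_mul trmxK.
have nzM : X^T *m X != 0 by apply: contra nzX => /eqP/trmx_mul_self_eq0 ->.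
have [l nzl /eigenvalueP[v vM nzv]] := symmetric_nonzero_eigenvalue symM nzM.
pose q := (v *m v^T) 0 0.
have q_gt0 : 0 < q.
  rewrite lt_def; apply/andP; split; last first.
    by rewrite /q mxE sumr_ge0 // => i _; rewrite mxE -expr2 sqr_ge0.
  apply: contra nzv => /eqP q0; apply/eqP/trmx_inj; rewrite trmx0.
  by apply: trmx_mul_self_eq0; rewrite trmxK [LHS]mx11_scalar -/q q0 raddf0.
pose b := (Num.sqrt q)^-1 *: v^T.
have sq0 : Num.sqrt q != 0 by rewrite gt_eqF // sqrtr_gt0.
have bT : b^T = (Num.sqrt q)^-1 *: v by rewrite /b linearZ /= trmxK.
have bb : b^T *m b = 1%:M.
  rewrite bT -scalemxAl -scalemxAr scalerA [v *m _]mx11_scalar.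
  rewrite -/q scale_scalar_mx -{3}(sqr_sqrtr (ltW q_gt0)).
  by rewrite expr2 -invfM mulVf ?mulf_neq0.
have bM : b^T *m (X^T *m X) = l *: b^T.
  by rewrite bT -scalemxAl vM !scalerA mulrC.
have lE : l%:M = (X *m b)^T *m (X *m b).
  by rewrite trmx_mul -mulmxA (mulmxA X^T) mulmxA bM -scalemxAl bb scale_scalar_mx mulr1.
have l_gt0 : 0 < l.
  rewrite lt_def nzl /=; move/(congr1 (fun M : 'M_1 => M 0 0)): lE.
  rewrite [X in X = _ -> _]mxE eqxx mulr1n => ->.
  by rewrite mxE sumr_ge0 // => i _; rewrite mxE -expr2 sqr_ge0.
have sl0 : Num.sqrt l != 0 by rewrite gt_eqF // sqrtr_gt0.
have trZ : ((Num.sqrt l)^-1 *: (X *m b))^T = (Num.sqrt l)^-1 *: (X *m b)^T.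
  by rewrite linearZ.
exists (Num.sqrt l), ((Num.sqrt l)^-1 *: (X *m b)), b; split => //.
- by rewrite sqrtr_gt0.
- rewrite trZ -scalemxAl -scalemxAr -lE scalerA scale_scalar_mx.
  by rewrite -{3}(sqr_sqrtr (ltW l_gt0)) expr2 -invfM mulVf ?mulf_neq0.
- by rewrite scalerA divff // scale1r.
- rewrite trZ -scalemxAl trmx_mul -mulmxA bM scalerA; congr (_ *: _).
  by rewrite -{2}(sqr_sqrtr (ltW l_gt0)) expr2 mulKf.
Qed.

(* Deflation: peel off one singular pair at a time, by induction on the rank. *)
Lemma thin_svd (R : rcfType) m n (X : 'M[R]_(m, n)) :
  exists p (A : 'M[R]_(m, p)) (s : 'rV[R]_p) (B : 'M[R]_(n, p)),
    [/\ A^T *m A = 1%:M, B^T *m B = 1%:M, forall i, 0 < s 0 i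
      & X = A *m diag_mx s *m B^T].
Proof.
have [r] := ubnP (\rank X); elim: r X => // r IHr X rX.
have [->|nzX] := eqVneq X 0.
  exists 0, 0, 0, 0; split; rewrite ?mul0mx //; try by apply/matrixP=> -[].
  by case.
have [t [a [b [t0 aa bb Xb aX]]]] := singular_pair nzX.
pose X1 := X - t *: (a *m b^T).
have nt : t != 0 by rewrite gt_eqF.
have bX : (b^T <= X)%MS.
  by apply/submxP; exists (t^-1 *: a^T); rewrite -scalemxAl aX scalerA mulVf ?scale1r.
have X1b : X1 *m b = 0.
  by rewrite mulmxBl Xb -scalemxAl -mulmxA bb mulmx1 subrr.
have aX1 : a^T *m X1 = 0.
  by rewrite mulmxBr aX -scalemxAr mulmxA aa mul1mx subrr.
(* The rank drops: [b^T] lies in the row space of [X], but not in that of [X1], which annihilates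
   [b]. *)
have ltX1 : (X1 < X)%MS.
  rewrite ltmxE; apply/andP; split.
    by rewrite addmx_sub // -scaleN1r !scalemx_sub // mulmx_sub.
  apply/negP => XX1; have /submxP[c bc] := submx_trans bX XX1.
  have := bb; rewrite bc -mulmxA X1b mulmx0 => /matrixP/(_ 0 0).
  by rewrite !mxE => /esym/eqP; rewrite oner_eq0.
have [|p [A [s [B [AA BB s0 X1E]]]]] := IHr X1.
  by apply: leq_trans (_ : \rank X <= r)%N => //; rewrite ltmxErank in ltX1; case/andP: ltX1.
(* Cancelling the invertible [diag_mx s] in [aX1] and [X1b] makes the new pair orthogonal to the
   columns of [A] and [B]. *)
have us : diag_mx s \in unitmx.
  rewrite unitmxE det_diag unitfE; apply/prodf_neq0 => i _.
  by rewrite gt_eqF.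
have aA : a^T *m A = 0.
  have : a^T *m X1 *m B = 0 by rewrite aX1 mul0mx.
  rewrite X1E !mulmxA -mulmxA BB mulmx1 => /(congr1 (mulmx^~ (invmx (diag_mx s)))).
  by rewrite mulmxK // mul0mx.
have Bb : B^T *m b = 0.
  have : A^T *m (X1 *m b) = 0 by rewrite X1b mulmx0.
  rewrite X1E !mulmxA AA mul1mx -mulmxA => /(congr1 (mulmx (invmx (diag_mx s)))).
  by rewrite mulKmx // mulmx0.
exists (1 + p)%N, (row_mx a A), (row_mx t%:M s), (row_mx b B); split.
- rewrite tr_row_mx mul_col_row aa AA aA -[A^T *m a]trmxK trmx_mul trmxK aA.
  by rewrite trmx0 -scalar_mx_block.
- rewrite tr_row_mx mul_col_row bb BB Bb -[b^T *m B]trmxK trmx_mul trmxK Bb.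
  by rewrite trmx0 -scalar_mx_block.
- move=> i; rewrite mxE; case: splitP => j _; last exact: s0.
  by rewrite mxE !ord1 eqxx mulr1n.
- have -> : diag_mx (row_mx t%:M s) = block_mx t%:M 0 0 (diag_mx s).
    apply/matrixP=> i j; rewrite !mxE -(inj_eq (@ord_inj _)).
    case: splitP => i' ii; rewrite !mxE; case: splitP => j' jj; rewrite ?mxE.
    + by rewrite !ord1 ii jj !ord1 eqxx !mulr1n.
    + by rewrite ii jj !ord1 /= mulr0n.
    + by rewrite ii jj !ord1 /= mulr0n.
    + by rewrite ii jj eqn_add2l.
  rewrite tr_row_mx mul_row_block !mulmx0 addr0 add0r mul_row_col.
  by rewrite mul_mx_scalar -scalemxAl -X1E /X1 addrC subrK.
Qed.

(** * Singular values and the regularizer read off a decomposition *)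

Lemma count_eigenvalues (R : realType) n (A : 'M[R]_n) x :
  count_mem x (eigenvalues A) = mup x (char_poly A).
Proof.
have nzA : char_poly A != 0 by rewrite monic_neq0 ?char_poly_monic.
have uroots : uniq (rootsR (char_poly A)).
  exact/lt_sorted_uniq/sorted_roots.
rewrite /eigenvalues count_flatten -map_comp map_rev sumn_rev.
under eq_map => y do rewrite /= count_nseq /=.
rewrite sumnE big_map; have [xr|nxr] := boolP (x \in rootsR (char_poly A)).
  rewrite (bigD1_seq x) //= eqxx mul1n big1 ?addn0 // => y /negPf xy.
  by rewrite xy mul0n.
rewrite big1_seq => [|y /andP[_ yr]]; last first.
  by case: eqP yr nxr => [->->//|_ _ _]; rewrite mul0n.
apply/esym/mupNroot; apply: contra nxr => rx.
by rewrite -(roots_on_rootsR nzA) rx andbT.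
Qed.

Lemma eigenvalues_sorted (R : realType) n (A : 'M[R]_n) :
  sorted >=%R (eigenvalues A).
Proof.
have : sorted >%R (rev (rootsR (char_poly A))).
  by rewrite rev_sorted; exact: sorted_roots.
rewrite /eigenvalues; elim: (rev _) => //= y t IHt.
rewrite path_sortedE; last by move=> a b c ab bc; exact: lt_trans bc ab.
move=> /andP[/allP ly /IHt {}IHt].
have ge_tr : transitive (>=%R : rel R) by move=> a b c ab bc; exact: le_trans bc ab.
rewrite sorted_pairwise // pairwise_cat -!sorted_pairwise // IHt andbT.
apply/andP; split; last first.
  by elim: (mup _ _) => //= -[|k] //= ->; rewrite lexx.
apply/allrelP => a b /nseqP[-> _] /flattenP[_ /mapP[z zt ->]] /nseqP[-> _].
exact/ltW/ly.
Qed.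

Lemma perm_eigenvalues (R : realType) n (A : 'M[R]_n) (s : seq R) :
  char_poly A = \prod_(x <- s) ('X - x%:P) -> perm_eq (eigenvalues A) s.
Proof.
move=> As; apply/allP => x _ /=.
by rewrite count_eigenvalues As mu_prod_XsubC.
Qed.

Lemma singular_value_ge0 (R : realType) m n (X : 'M[R]_(m, n)) i :
  0 <= singular_value X i.
Proof. exact: sqrtr_ge0. Qed.

Lemma singular_value_nonincr (R : realType) m n (X : 'M[R]_(m, n)) i j :
  (i <= j)%N -> singular_value X j <= singular_value X i.
Proof.
move=> ij; rewrite /singular_value; set e := eigenvalues _.
(* Past the end of the list [nth] gives the default 0, which is below every square root. *)
have [je|ej] := ltnP j (size e); last by rewrite [nth _ _ j]nth_default // sqrtr0 sqrtr_ge0.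
apply: ler_wsqrtr.
apply: (sorted_leq_nth _ _ _ (eigenvalues_sorted (X^T *m X))) => //.
- by move=> a b c ab bc; exact: le_trans bc ab.
- exact: lexx.
- by rewrite inE (leq_ltn_trans ij je).
Qed.

Lemma orthonormal_cols_leq (R : fieldType) m p (A : 'M[R]_(m, p)) :
  A^T *m A = 1%:M -> (p <= m)%N.
Proof.
by move=> AA; rewrite -(mxrank1 R p) -AA (leq_trans (mxrankM_maxl _ _)) // rank_leq_col.
Qed.

(** By Sylvester's identity the spectrum of [X^T *m X] consists of the squares of the [s 0 i] and n
    - p zeros. The zeros contribute nothing because [rhat 0 = 0], and the order of the [s 0 i] is
    lost in the sum. *)
Lemma spectral_reg_svd (R : realType) (rhat : R -> R) m n p
    (A : 'M[R]_(m, p)) (s : 'rV[R]_p) (B : 'M[R]_(n, p)) :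
  rhat 0 = 0 -> A^T *m A = 1%:M -> B^T *m B = 1%:M -> (forall i, 0 <= s 0 i) ->
  spectral_reg rhat (A *m diag_mx s *m B^T) = \sum_i rhat (s 0 i).
Proof.
move=> rhat0 AA BB s_ge0; set X := _ *m _.
have pm := orthonormal_cols_leq AA; have pn := orthonormal_cols_leq BB.
pose sq := [seq s 0 i ^+ 2 | i <- enum 'I_p].
pose e := sort >=%R sq ++ nseq (n - p) 0.
have size_e : size (sort >=%R sq) = p by rewrite size_sort size_map size_enum_ord.
have charX : char_poly (X^T *m X) = \prod_(x <- e) ('X - x%:P).
  have XX : X^T *m X = (B *m diag_mx s *m diag_mx s) *m B^T.
    rewrite /X !trmx_mul trmxK tr_diag_mx !mulmxA; congr (_ *m _ *m _).
    by rewrite -!mulmxA AA mulmx1.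
  have := char_poly_sylvester (B *m diag_mx s *m diag_mx s) B^T.
  rewrite -XX !mulmxA BB mul1mx mulmx_diag [char_poly (diag_mx _)]char_poly_trig ?diag_mx_is_trig //.
  have -> : 'X^n = 'X^p * 'X^(n - p) :> {poly R} by rewrite -exprD subnKC.
  rewrite -mulrA.
  move/(mulfI _) => ->; last by rewrite expf_neq0 ?polyX_eq0.
  rewrite big_cat big_nseq subr0 mulrC /=.
  rewrite (perm_big sq) ?perm_sort //= big_map enumT; congr (_ * _).
    by apply: eq_bigr => i _; rewrite !mxE eqxx mulr1n expr2.
  by elim: (n - p)%N => //= k <-; rewrite exprS.
have ge_tr : transitive (>=%R : rel R) by move=> a b c ab bc; exact: le_trans bc ab.
have ge_anti : antisymmetric (>=%R : rel R) by move=> a b /le_anti.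
have ge_tot : total (>=%R : rel R) by move=> a b; exact: le_total.
have sorted_e : sorted >=%R e.
  rewrite sorted_pairwise // pairwise_cat -!sorted_pairwise // sort_sorted //=.
  apply/andP; split; last by elim: (n - p)%N => //= -[|k] //= ->; rewrite lexx.
  apply/allrelP => a b; rewrite mem_sort => /mapP[i _ ->] /nseqP[-> _].
  exact: sqr_ge0.
(* Two decreasing lists with the same multiplicities coincide. *)
have eE : eigenvalues (X^T *m X) = e.
  apply: (sorted_eq ge_tr ge_anti) => //; first exact: eigenvalues_sorted.
  exact: perm_eigenvalues.
rewrite /spectral_reg /singular_value eE.
have pmn : (p <= minn m n)%N by rewrite leq_min pm pn.
rewrite (bigID (fun i : 'I__ => (i < p)%N)) /= [X in _ + X]big1 ?addr0; last first.
  move=> i; rewrite -leqNgt => pi.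
  by rewrite nth_cat size_e ltnNge pi /= nth_nseq if_same sqrtr0.
rewrite (big_ord_narrow pmn) /=.
transitivity (\sum_(x <- sort >=%R sq) rhat (Num.sqrt x)).
  rewrite (big_nth 0) size_e big_mkord; apply: eq_bigr => i _.
  by rewrite nth_cat size_e ltn_ord.
rewrite (perm_big sq) ?perm_sort //= big_map enumT; apply: eq_bigr => i _.
by rewrite sqrtr_sqr ger0_norm.
Qed.

(** * The objective along a decomposition *)

Lemma tr_self_sum (R : pzRingType) m n (A : 'M[R]_(m, n)) j :
  (A^T *m A) j j = \sum_i A i j ^+ 2.
Proof. by rewrite mxE; apply: eq_bigr => i _; rewrite mxE expr2. Qed.

Lemma frobenius_norm_sqr (R : realType) m n (A : 'M[R]_(m, n)) :
  frobenius_norm A ^+ 2 = \tr (A^T *m A).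
Proof.
rewrite sqr_sqrtr; last by do 2!apply: sumr_ge0 => ? _; rewrite sqr_ge0.
by rewrite exchange_big; apply: eq_bigr => j _; rewrite tr_self_sum.
Qed.

Definition prox_objective (R : realType) (mu : R) (rhat : R -> R) m n
    (Z X : 'M[R]_(m, n)) : R :=
  2^-1 * frobenius_norm (X - Z) ^+ 2 + mu * spectral_reg rhat X.

(** The function h of the opening sketch: the cost of a singular value [y] apart from its
    interaction with [Z]. *)
Definition singular_cost (R : realType) (mu : R) (rhat : R -> R) (y : R) : R :=
  2^-1 * y ^+ 2 + mu * rhat y.

(** Expand the square as traces; orthonormality reduces the quadratic term to the squares of the
    [s 0 i] and the cross term to diagonal entries. Zero values are allowed, since the competitor
    built later may have some. *)
Lemma prox_objective_svd (R : realType) (mu : R) (rhat : R -> R) m n p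
    (Z : 'M[R]_(m, n)) (A : 'M[R]_(m, p)) (s : 'rV[R]_p) (B : 'M[R]_(n, p)) :
  rhat 0 = 0 -> A^T *m A = 1%:M -> B^T *m B = 1%:M -> (forall i, 0 <= s 0 i) ->
  prox_objective mu rhat Z (A *m diag_mx s *m B^T) =
    2^-1 * \tr (Z^T *m Z) +
    \sum_i (singular_cost mu rhat (s 0 i) - s 0 i * (A^T *m Z *m B) i i).
Proof.
move=> rhat0 AA BB s0; rewrite /prox_objective spectral_reg_svd //.
rewrite frobenius_norm_sqr; set X := A *m _ *m _.
have XT : X^T = B *m diag_mx s *m A^T.
  by rewrite /X !trmx_mul trmxK tr_diag_mx mulmxA.
have XX : \tr (X^T *m X) = \sum_i s 0 i ^+ 2.
  rewrite XT /X -!mulmxA (mulmxA A^T) AA mul1mx mxtrace_mulC -!mulmxA BB mulmx1.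
  by rewrite mulmx_diag mxtrace_diag; apply: eq_bigr => i _; rewrite mxE expr2.
have XZ : \tr (X^T *m Z) = \sum_i s 0 i * (A^T *m Z *m B) i i.
  rewrite XT -!mulmxA mxtrace_mulC -!mulmxA mul_diag_mx.
  by apply: eq_bigr => i _; rewrite mxE mulmxA.
have ZX : \tr (Z^T *m X) = \tr (X^T *m Z).
  by rewrite -mxtrace_tr trmx_mul trmxK.
rewrite [(X - Z)^T]linearB /= mulmxBl !mulmxBr !linearB /= ZX XX XZ sumrB big_split /=.
by rewrite -!mulr_sumr; field.
Qed.

(** * Bessel's inequality, the bilinear bound and the choice of new singular values *)

(** Pythagoras: [D] is the part of [A] orthogonal to the columns of [U]. The diagonal entries give
    Bessel's inequality and its equality case. *)
Lemma bessel_gram (R : comNzRingType) m k p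
    (U : 'M[R]_(m, k)) (A : 'M[R]_(m, p)) :
  U^T *m U = 1%:M -> A^T *m A = 1%:M ->
  let D := A - U *m (U^T *m A) in
  D^T *m D = 1%:M - (U^T *m A)^T *m (U^T *m A).
Proof.
move=> UU AA /=; set C := U^T *m A.
have AU : A^T *m U = C^T by rewrite trmx_mul trmxK.
rewrite [(A - _)^T]linearB /= trmx_mul mulmxBl !mulmxBr AA mulmxA AU.
by rewrite -!mulmxA -/C (mulmxA U^T) UU mul1mx subrr subr0.
Qed.

Lemma bessel_le1 (R : realDomainType) m k p
    (U : 'M[R]_(m, k)) (A : 'M[R]_(m, p)) i :
  U^T *m U = 1%:M -> A^T *m A = 1%:M -> \sum_j (U^T *m A) j i ^+ 2 <= 1.
Proof.
move=> UU AA; rewrite -tr_self_sum -subr_ge0.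
have /(congr1 (fun M : 'M_p => M i i)) := bessel_gram UU AA.
have -> (G : 'M[R]_p) : (1%:M - G) i i = 1 - G i i by rewrite !mxE eqxx.
move=> <-.
by rewrite tr_self_sum sumr_ge0 // => j _; rewrite sqr_ge0.
Qed.

Lemma bessel_eq1 (R : realDomainType) m k p
    (U : 'M[R]_(m, k)) (A : 'M[R]_(m, p)) :
  U^T *m U = 1%:M -> A^T *m A = 1%:M ->
  (forall i, \sum_j (U^T *m A) j i ^+ 2 = 1) -> A = U *m (U^T *m A).
Proof.
move=> UU AA C1; apply/eqP; rewrite -subr_eq0; apply/eqP.
set D := A - _; apply/matrixP => j i; rewrite [RHS]mxE.
have /(congr1 (fun M : 'M_p => M i i)) := bessel_gram UU AA.
have -> (G : 'M[R]_p) : (1%:M - G) i i = 1 - G i i by rewrite !mxE eqxx.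
rewrite -/D !tr_self_sum C1 subrr => /eqP; rewrite psumr_eq0; last first.
  by move=> ? _; rewrite sqr_ge0.
by move=> /allP/(_ j); rewrite mem_index_enum sqrf_eq0 => /(_ isT)/eqP.
Qed.

(* AM-GM on each product [a j * b l], then the tail coefficients are at most
   [g]. *)
Lemma diag_bilinear_le (R : realFieldType) m n k (km : (k <= m)%N)
    (kn : (k <= n)%N) (sv : nat -> R) (g : R) (a : 'I_m -> R) (b : 'I_n -> R) :
  (forall j, 0 <= sv j) -> 0 <= g ->
  (forall j, (k <= j)%N -> (j < m)%N -> (j < n)%N -> sv j <= g) ->
  \sum_j a j ^+ 2 = 1 -> \sum_j b j ^+ 2 = 1 ->
  let w j := 2^-1 * (a (widen_ord km j) ^+ 2 + b (widen_ord kn j) ^+ 2) in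
  \sum_(j < m) \sum_(l < n) a j * (sv j *+ (j == l :> nat)) * b l <=
    \sum_(j < k) sv j * w j + g * (1 - \sum_j w j).
Proof.
move=> sv0 g0 svg a1 b1; set w := fun j => _.
(* [c] bounds the row and column sums of the rectangular diagonal matrix of the [sv j]; each row or
   column has at most one nonzero entry. *)
pose c j := if (j < k)%N then sv j else g.
have c0 j : 0 <= c j by rewrite /c; case: ifP.
(* For a unit vector the mass beyond index k is 1 minus the mass before it. *)
have split_le q (kq : (k <= q)%N) (x : 'I_q -> R) : \sum_j x j ^+ 2 = 1 ->
    \sum_(j < q) c j * x j ^+ 2 = \sum_(j < k) sv j * x (widen_ord kq j) ^+ 2 +
      g * (1 - \sum_j x (widen_ord kq j) ^+ 2).
  move=> x1; rewrite -x1 (bigID (fun j : 'I_q => (j < k)%N)) /=.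
  rewrite [in RHS](bigID (fun j : 'I_q => (j < k)%N)) /=.
  rewrite !(big_ord_narrow kq) /= [X in g * X]addrAC subrr add0r mulr_sumr.
  congr (_ + _); apply: eq_bigr => j; rewrite /c /= ?ltn_ord //.
  by move=> /negPf ->.
have ca (j : 'I_m) : \sum_(l < n) sv j *+ (j == l :> nat) <= c j.
  have [jn|nj] := ltnP j n; last first.
    rewrite big1 // => l _; case: eqP => // jl.
    by have := ltn_ord l; rewrite -jl ltnNge nj.
  rewrite (bigD1 (Ordinal jn)) //= eqxx mulr1n big1 ?addr0.
    by rewrite /c; case: ltnP => // kj; apply: svg.
  move=> l; rewrite -(inj_eq (@ord_inj _)) /= eq_sym => /negPf ->.
  by rewrite mulr0n.
have cb (l : 'I_n) : \sum_(j < m) sv j *+ (j == l :> nat) <= c l.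
  have [lm|ml] := ltnP l m; last first.
    rewrite big1 // => j _; case: eqP => // jl.
    by have := ltn_ord j; rewrite jl ltnNge ml.
  rewrite (bigD1 (Ordinal lm)) //= eqxx mulr1n big1 ?addr0.
    by rewrite /c; case: ltnP => // kj; apply: svg.
  move=> j; rewrite -(inj_eq (@ord_inj _)) /= => /negPf ->.
  by rewrite mulr0n.
pose S j l := sv j *+ (j == l).
have S0 j l : 0 <= S j l by rewrite /S mulrn_wge0.
apply: (@le_trans _ _ (\sum_(j < m) \sum_(l < n)
    (2^-1 * (S j l * a j ^+ 2) + 2^-1 * (S j l * b l ^+ 2)))).
  apply: ler_sum => j _; apply: ler_sum => l _; rewrite -/(S j l).
  have := mulr_ge0 (S0 j l) (sqr_ge0 (a j - b l)).
  by rewrite sqrrB; lra.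
have -> : \sum_(j < k) sv j * w j + g * (1 - \sum_j w j) =
    2^-1 * \sum_(j < m) c j * a j ^+ 2 + 2^-1 * \sum_(j < n) c j * b j ^+ 2.
  rewrite (split_le _ km) // (split_le _ kn) // /w -mulr_sumr big_split /=.
  under eq_bigr => j _ do rewrite mulrCA mulrDr.
  by rewrite -mulr_sumr big_split /=; field.
under eq_bigr => j _ do rewrite big_split /=.
rewrite big_split /= [X in _ + X]exchange_big /=; apply: lerD.
- rewrite mulr_sumr; apply: ler_sum => j _.
  by rewrite -mulr_sumr -mulr_suml ler_wpM2l ?invr_ge0 // ler_wpM2r ?sqr_ge0 ?ca.
- rewrite mulr_sumr; apply: ler_sum => j _.
  by rewrite -mulr_sumr -mulr_suml ler_wpM2l ?invr_ge0 // ler_wpM2r ?sqr_ge0 ?cb.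
Qed.

(** The least candidate value is at most 0, because y = 0 is a candidate, so it is at most the
    average of the others with weights [w j i] of total at most 1. A finite candidate set ensures
    that the minimum is attained, whatever [h] is. *)
Lemma substochastic_selection (R : realFieldType) (p k : nat) (h : R -> R)
    (g : R) (sv : 'I_k -> R) (s t : 'I_p -> R) (w : 'I_k -> 'I_p -> R) :
  h 0 = 0 -> (forall i, 0 < s i) ->
  (forall j i, 0 <= w j i) -> (forall j, \sum_i w j i <= 1) ->
  (forall i, t i <= \sum_j sv j * w j i + g * (1 - \sum_j w j i)) ->
  exists2 y : 'I_k -> R, forall j, 0 <= y j &
    \sum_j (h (y j) - y j * sv j) +
      \sum_i (1 - \sum_j w j i) * (h (s i) - g * s i) <=
    \sum_i (h (s i) - s i * t i).
Proof.
move=> h0 s0 w0 w1 tw.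
(* [None] encodes the candidate 0 and [Some i] the candidate [s i]. *)
pose v (o : option 'I_p) := oapp s 0 o.
pose f j (o : option 'I_p) := h (v o) - v o * sv j.
pose y j := v [arg min_(o < None) f j o]%O.
have yP j o : h (y j) - y j * sv j <= f j o.
  by rewrite /y; case: arg_minP => // o' _ /(_ o); apply.
exists y => [j|]; first by rewrite /y; case: [arg min_(_ < _) _]%O => //= i; exact: ltW.
apply: (@le_trans _ _ (\sum_j \sum_i w j i * (h (s i) - s i * sv j) +
    \sum_i (1 - \sum_j w j i) * (h (s i) - g * s i))).
  rewrite lerD2r; apply: ler_sum => j _.
  have c0 : h (y j) - y j * sv j <= 0.
    by have := yP j None; rewrite /f /= h0 mul0r subr0.
  apply: (@le_trans _ _ (\sum_i w j i * (h (y j) - y j * sv j))).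
    by rewrite -mulr_suml -subr_ge0; have := w1 j; nra.
  by apply: ler_sum => i _; rewrite ler_wpM2l // (yP j (Some i)).
rewrite exchange_big -big_split /=; apply: ler_sum => i _.
have -> : \sum_j w j i * (h (s i) - s i * sv j) =
    (\sum_j w j i) * h (s i) - s i * \sum_j sv j * w j i.
  rewrite mulr_suml mulr_sumr -sumrB; apply: eq_bigr => j _; ring.
by have := ler_wpM2l (ltW (s0 i)) (tw i); lra.
Qed.

(** By monotonicity, a value above [g] at index j >= k would give j + 1 > k such indices. *)
Lemma singular_value_tail_le (R : realType) m n (Z : 'M[R]_(m, n)) (g : R) k :
  #|[set i : 'I_(minn m n) | g < singular_value Z i]%SET| = k ->
  forall j, (k <= j)%N -> (j < m)%N -> (j < n)%N -> singular_value Z j <= g.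
Proof.
move=> kE j kj jm jn; rewrite leNgt; apply/negP => gj.
have jmn : (j.+1 <= minn m n)%N by rewrite leq_min jm jn.
have sub : widen_ord jmn @: [set: 'I_j.+1]%SET \subset
    [set i : 'I_(minn m n) | g < singular_value Z i]%SET.
  apply/fintype.subsetP => _ /imsetP[i _ ->]; rewrite inE /=.
  by apply: lt_le_trans gj _; apply: singular_value_nonincr; rewrite -ltnS.
have := subset_leq_card sub; rewrite kE card_imset; last first.
  by move=> x y /(congr1 val) /= /val_inj.
by rewrite cardsT card_ord ltnNge kj.
Qed.

(** At sigma = g the scalar objective at [y] exceeds its value at 0 by
    [singular_cost mu rhat y - g * y]. Were this not positive, [y] would be a second minimizer. *)
Lemma threshold_cost_gt (R : realType) (mu g : R) (rhat : R -> R) y :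
  rhat 0 = 0 -> is_threshold mu rhat g -> 0 < y ->
  g * y < singular_cost mu rhat y.
Proof.
move=> rhat0 [g0 /(_ g)]; rewrite lexx (ltW g0) => /(_ isT) argE y0.
have [_ min0] : argmin [set y | 0 <= y]
    (fun y => 2^-1 * (y - g) ^+ 2 + mu * rhat y) 0 by rewrite argE.
rewrite ltNge; apply/negP => le_y.
have : argmin [set y | 0 <= y]
    (fun y => 2^-1 * (y - g) ^+ 2 + mu * rhat y) y.
  split; first exact: ltW.
  move=> z z0; apply: le_trans (min0 z z0).
  by move: le_y; rewrite /singular_cost rhat0; lra.
by rewrite argE /= => y_eq0; rewrite y_eq0 ltxx in y0.
Qed.

Lemma orthonormal_colsub (R : pzRingType) q p (f : 'I_p -> 'I_q) (W : 'M[R]_q) :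
  injective f -> W^T *m W = 1%:M -> (colsub f W)^T *m colsub f W = 1%:M.
Proof.
move=> f_inj WW; apply/matrixP => i j.
have /matrixP/(_ (f i) (f j)) := WW.
by rewrite !mxE (inj_eq f_inj) => <-; apply: eq_bigr => l _; rewrite !mxE.
Qed.

(** * Comparison of any matrix with one of the form [Uk *m W] *)

Section TruncatedSVD.
Variables (R : realType) (mu : R) (rhat : R -> R) (gamma : R).
Variables (m n khat : nat) (Z : 'M[R]_(m, n)).
Variables (Uk : 'M[R]_(m, khat)) (Sk : 'M[R]_khat) (Vk : 'M[R]_(n, khat)).
Hypothesis rhat0 : rhat 0 = 0.
Hypothesis gamma_threshold : is_threshold mu rhat gamma.
Hypothesis Z_khat :
  #|[set i : 'I_(minn m n) | gamma < singular_value Z i]%SET| = khat.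
Hypothesis Z_svd : is_truncated_svd Z Uk Sk Vk.

(** The w_ji of the opening sketch; averaging the two squares is what AM-GM produces from products
    of left and right coordinates. *)
Definition overlap_weight p (A : 'M[R]_(m, p)) (B : 'M[R]_(n, p)) (j : 'I_khat) (i : 'I_p) :=
  2^-1 * ((Uk^T *m A) j i ^+ 2 + (Vk^T *m B) j i ^+ 2).

Lemma truncated_svd_orthonormal : Uk^T *m Uk = 1%:M /\ Vk^T *m Vk = 1%:M.
Proof.
case: Z_svd => U [V [km [kn [[UU VV _] -> _ ->]]]].
by split; apply: orthonormal_colsub => // x y /(congr1 val) /= /val_inj.
Qed.

Lemma truncated_svd_diag j : (Uk^T *m Z *m Vk) j j = singular_value Z j.
Proof.
case: Z_svd => U [V [km [kn [[UU VV defZ] -> _ ->]]]].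
have : U^T *m Z *m V = singular_mx Z.
  by rewrite {1}defZ -!mulmxA VV mulmx1 mulmxA UU mul1mx.
move=> /matrixP/(_ (widen_ord km j) (widen_ord kn j)).
rewrite [RHS]mxE /= eqxx mulr1n => <-; rewrite !mxE; apply: eq_bigr => l _.
by rewrite !mxE; congr (_ * _); apply: eq_bigr => i _; rewrite !mxE.
Qed.

(** In the full bases [U] and [V] the entry is a bilinear form of [singular_mx Z] at two vectors,
    which are unit because [U] and [V] are square orthogonal. *)
Lemma truncated_svd_diag_le p (A : 'M[R]_(m, p)) (B : 'M[R]_(n, p)) i :
  A^T *m A = 1%:M -> B^T *m B = 1%:M ->
  (A^T *m Z *m B) i i <= \sum_(j < khat) singular_value Z j * overlap_weight A B j i +
    gamma * (1 - \sum_j overlap_weight A B j i).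
Proof.
move=> AA BB; have tail := singular_value_tail_le Z_khat.
have g0 : 0 <= gamma by case: gamma_threshold => /ltW.
rewrite /overlap_weight; case: Z_svd => U [V [km [kn [[UU VV defZ] -> _ ->]]]].
pose C := U^T *m A; pose D := V^T *m B.
have CC : C^T *m C = 1%:M.
  by rewrite trmx_mul trmxK -mulmxA (mulmxA U) (mulmx1C UU) mul1mx.
have DD : D^T *m D = 1%:M.
  by rewrite trmx_mul trmxK -mulmxA (mulmxA V) (mulmx1C VV) mul1mx.
have C1 : \sum_j C j i ^+ 2 = 1 by rewrite -tr_self_sum CC mxE eqxx.
have D1 : \sum_j D j i ^+ 2 = 1 by rewrite -tr_self_sum DD mxE eqxx.
have := diag_bilinear_le km kn (singular_value_ge0 Z) g0 tail C1 D1.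
rewrite /= => bound; have -> : A^T *m Z *m B = C^T *m (singular_mx Z *m D).
  by rewrite {1}defZ trmx_mul trmxK !mulmxA.
have -> : (C^T *m (singular_mx Z *m D)) i i =
    \sum_(j < m) \sum_(l < n) C j i * (singular_value Z j *+ (j == l :> nat)) * D l i.
  rewrite mxE; apply: eq_bigr => j _; rewrite !mxE mulr_sumr.
  by apply: eq_bigr => l _; rewrite !mxE mulrA.
apply: le_trans bound _; rewrite le_eqVlt; apply/orP; left; apply/eqP.
have CE j : ((colsub (widen_ord km) U)^T *m A) j i = C (widen_ord km j) i.
  by rewrite !mxE; apply: eq_bigr => l _; rewrite !mxE.
have DE j : ((colsub (widen_ord kn) V)^T *m B) j i = D (widen_ord kn j) i.
  by rewrite !mxE; apply: eq_bigr => l _; rewrite !mxE.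
by congr (_ + _ * (1 - _)); apply: eq_bigr => j _; rewrite CE DE.
Qed.

(** The first clause lets minimality be tested on matrices [Uk *m W] only; the second, the equality
    case, puts every minimizer in that form. *)
Lemma truncated_competitor (X : 'M[R]_(m, n)) :
  exists W : 'M[R]_(khat, n),
    prox_objective mu rhat Z (Uk *m W) <= prox_objective mu rhat Z X /\
    (prox_objective mu rhat Z X <= prox_objective mu rhat Z (Uk *m W) ->
     exists W' : 'M[R]_(khat, n), X = Uk *m W').
Proof.
have [p [A [s [B [AA BB s0 ->]]]]] := thin_svd X.
have [UU VV] := truncated_svd_orthonormal.
set h := singular_cost mu rhat.
have h0 : h 0 = 0 by rewrite /h /singular_cost rhat0 expr0n /= !mulr0 addr0.
have hs i : 0 < h (s 0 i) - gamma * s 0 i.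
  by rewrite subr_gt0 threshold_cost_gt.
have w0 j i : 0 <= overlap_weight A B j i.
  by rewrite /overlap_weight mulr_ge0 ?invr_ge0 // addr_ge0 ?sqr_ge0.
(* Bessel with the roles exchanged: the columns of [Uk] and [Vk] are projected onto those of [A] and
   [B]. *)
have w_row j : \sum_i overlap_weight A B j i <= 1.
  have UA : \sum_i (Uk^T *m A) j i ^+ 2 <= 1.
    rewrite (le_trans _ (bessel_le1 j AA UU)) // ler_sum // => i _.
    suff -> : (A^T *m Uk) i j = (Uk^T *m A) j i by [].
    by rewrite -[A^T *m Uk]trmxK trmx_mul trmxK [LHS]mxE.
  have VB : \sum_i (Vk^T *m B) j i ^+ 2 <= 1.
    rewrite (le_trans _ (bessel_le1 j BB VV)) // ler_sum // => i _.
    suff -> : (B^T *m Vk) i j = (Vk^T *m B) j i by [].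
    by rewrite -[B^T *m Vk]trmxK trmx_mul trmxK [LHS]mxE.
  by rewrite /overlap_weight -mulr_sumr big_split /=; lra.
have w_sum i : \sum_j overlap_weight A B j i =
    2^-1 * (\sum_j (Uk^T *m A) j i ^+ 2 + \sum_j (Vk^T *m B) j i ^+ 2).
  by rewrite /overlap_weight -mulr_sumr big_split.
have UA i := bessel_le1 i UU AA; have VB i := bessel_le1 i VV BB.
have [y y0 le_y] := substochastic_selection h0 s0 w0 w_row
  (fun i => truncated_svd_diag_le i AA BB).
pose yv := \row_j y j.
have yv0 j : 0 <= yv 0 j by rewrite mxE.
exists (diag_mx yv *m Vk^T); rewrite mulmxA.
rewrite !prox_objective_svd // -/h => [|i]; last exact: ltW.
rewrite !lerD2l.
have -> : \sum_i (h (yv 0 i) - yv 0 i * (Uk^T *m Z *m Vk) i i) =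
    \sum_(j < khat) (h (y j) - y j * singular_value Z j).
  by apply: eq_bigr => j _; rewrite truncated_svd_diag mxE.
have gap i : 0 <= (1 - \sum_j overlap_weight A B j i) * (h (s 0 i) - gamma * s 0 i).
  apply: mulr_ge0; last exact: ltW.
  by rewrite w_sum; have := UA i; have := VB i; lra.
split.
  apply: le_trans le_y; rewrite lerDl sumr_ge0 //.
(* This witness works once [A] equals its projection [Uk *m (Uk^T *m A)], the equality case of
   Bessel. *)
move=> le_X; exists (Uk^T *m A *m diag_mx s *m B^T); rewrite !mulmxA -[Uk *m _ *m A]mulmxA.
rewrite -(bessel_eq1 UU AA) // => i.
have gap0 : \sum_i (1 - \sum_j overlap_weight A B j i) * (h (s 0 i) - gamma * s 0 i) <= 0.
  by have := le_trans le_y le_X; rewrite gerDl.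
have : \sum_i (1 - \sum_j overlap_weight A B j i) * (h (s 0 i) - gamma * s 0 i) == 0.
  by rewrite eq_le gap0 sumr_ge0.
(* Every gap vanishes. Its factor [h (s 0 i) - gamma * s 0 i] is positive, so the weights sum to 1,
   and both Bessel sums, each at most 1, equal 1. *)
rewrite psumr_eq0 // => /allP/(_ i); rewrite mem_index_enum => /(_ isT) /=.
rewrite mulf_eq0 [X in _ || X]gt_eqF // orbF w_sum => /eqP.
by have := UA i; have := VB i; lra.
Qed.

End TruncatedSVD.

(** * Reduction to the smaller problem for [Q^T *m Z] *)

(** A decomposition of [Y] becomes one of [Q *m Y] with the same values on replacing [A] by
    [Q *m A]. The diagonal terms agree, so only the constants differ. *)
Lemma prox_objective_mulmx_orthonormal (R : realType) (mu : R) (rhat : R -> R)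
    m n k (Z : 'M[R]_(m, n)) (Q : 'M[R]_(m, k)) (Y : 'M[R]_(k, n)) :
  rhat 0 = 0 -> Q^T *m Q = 1%:M ->
  prox_objective mu rhat Z (Q *m Y) =
    prox_objective mu rhat (Q^T *m Z) Y +
    2^-1 * (\tr (Z^T *m Z) - \tr ((Q^T *m Z)^T *m (Q^T *m Z))).
Proof.
move=> rhat0 QQ; have [p [A [s [B [AA BB s0 ->]]]]] := thin_svd Y.
have QAQA : (Q *m A)^T *m (Q *m A) = 1%:M.
  by rewrite trmx_mul -mulmxA (mulmxA Q^T) QQ mul1mx.
rewrite !mulmxA !prox_objective_svd // => [|i|i]; try exact: ltW.
by rewrite (trmx_mul Q A) !mulmxA; ring.
Qed.

Theorem proposition3p3 (R : realType) (mu : R) (rhat : R -> R) (gamma : R)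
    (m n k khat : nat) (Z : 'M[R]_(m, n))
    (Uk : 'M[R]_(m, khat)) (Sk : 'M[R]_khat) (Vk : 'M[R]_(n, khat))
    (Q : 'M[R]_(m, k))
    (mu_gt0 : 0 < mu)
    (rhat_concave :
      convex_function (`[0, +oo[%classic : set R^o) (fun y => - rhat y))
    (rhat_nondecreasing :
      {in `[0, +oo[ &, {homo rhat : x y / x <= y}})
    (rhat0 : rhat 0 = 0)
    (gamma_threshold : is_threshold mu rhat gamma)
    (Z_khat : #|[set i : 'I_(minn m n) | gamma < singular_value Z i]%SET| = khat)
    (Z_svd : is_truncated_svd Z Uk Sk Vk)
    (khat_le_k : (khat <= k)%N)
    (Q_orthogonal : Q^T *m Q = 1%:M)
    (* inclusion of column spaces, as row spaces of the transposes *)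
    (span_UQ : (Uk^T <= Q^T)%MS) :
  prox mu rhat Z = mulmx Q @` prox mu rhat (Q^T *m Z).
Proof.
have [C UkE] : exists C, Uk = Q *m C.
  case/submxP: span_UQ => D UD; exists D^T.
  by rewrite -[Uk]trmxK UD trmx_mul trmxK.
have competitor X := truncated_competitor rhat0 gamma_threshold Z_khat Z_svd X.
have objQ Y := prox_objective_mulmx_orthonormal mu Z Y rhat0 Q_orthogonal.
apply/seteqP; split => [X [_ Xmin]|_ [Y [_ Ymin] <-]].
  (* Minimality of [X] triggers the equality case, so [X = Q *m (C *m W')]. *)
  have [W [_ /(_ (Xmin _ I))[W' XE]]] := competitor X.
  exists (C *m W'); last by rewrite XE UkE mulmxA.
  split=> // Y _; have := Xmin (Q *m Y) I.
  by rewrite -!/(prox_objective _ _ _ _) XE UkE -mulmxA !objQ lerD2r.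
(* Conversely, any [X] is bettered or matched by [Uk *m W = Q *m (C *m W)], against which [Y] is
   minimal. *)
split=> // X _; have [W [le_X _]] := competitor X.
apply: le_trans le_X; rewrite -!/(prox_objective _ _ _ _) UkE -mulmxA !objQ lerD2r.
exact: Ymin.
Qed.
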